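(* Let $w$ be a convex element of a twisted Weyl group and let $d\ge 0$ be an integer. Then $$\mathrm{DG}(b_w^d)=\mathrm{pb}(w)\quad\text{if and only if}\quad\mathrm{DG}(b_{w^{-1}}^d)=\mathrm{pb}(w).$$
   Context: Let $\mathfrak{R}$ be a crystallographic root system with positive roots $\mathfrak{R}_+$ and Weyl group $\tilde W$, and let $\Omega$ be a group of automorphisms of $\mathfrak R$ permuting the simple roots (''twists''). $W=\Omega\ltimes\tilde W$ is called a twisted Weyl group. For $w\in W$: $\mathfrak{R}_w=\{\beta\in\mathfrak{R}_+:w(\beta)\in-\mathfrak{R}_+\}$ is the inversion set and $\ell(w)=|\mathfrak{R}_w|$; $\mathfrak{R}^w_{\mathrm{st}}$ is the set of stable roots, i.e. roots $\beta$ such that either all $w^i(\beta)$ ($i\in\mathbb Z$) are positive or all are negative. The element $w$ is convex if $\mathfrak{R}^w_{\mathrm{st}}$ is a standard parabolic subsystem. Weak left Bruhat-Chevalley order: $y\ge x$ if and only if $\ell(y)=\ell(yx^{-1})+\ell(x)$, equivalently $\mathfrak{R}_x\subseteq\mathfrak{R}_y$. The twisted braid monoid has generators $b_x$ ($x\in W$) and relations $b_xb_y=b_{xy}$ whenever $\ell(xy)=\ell(x)+\ell(y)$. For a braid $b$, the (right) Deligne-Garside factor $\mathrm{DG}(b)$ is the largest element $x$ in the weak left order such that $b=b'b_x$ for some $b'$ in the monoid. Since twists have length $0$ it is determined up to left multiplication by twists, and equalities involving it are understood up to such twists (i.e. as equalities of inversion sets). For convex $w$, the braid power bound $\mathrm{pb}(w)$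 is the element with inversion set $\mathfrak{R}_+\setminus\mathfrak{R}^w_{\mathrm{st}}$, i.e. $w_\circ w_{\circ,J}$ where $w_\circ$ is the longest element and $w_{\circ,J}$ is the longest element of the standard parabolic subgroup with root system $\mathfrak{R}^w_{\mathrm{st}}$. *)

(* Defs.v *)
(* Mathematical Components, with finmap for finite sets of vectors. *)
From HB Require Import structures.
From mathcomp Require Import all_boot all_order all_algebra all_fingroup.
From mathcomp Require Import finmap.

Set Implicit Arguments.
Unset Strict Implicit.
Unset Printing Implicit Defensive.

Import Order.TTheory GRing.Theory Num.Theory.
Local Open Scope ring_scope.

Section Reflection.
Variables (R : realFieldType) (n : nat).
Implicit Types u v a : 'rV[R]_n.

Definition dot u v : R := (u *m v^T) 0 0.

Definition refl a v : 'rV[R]_n := v - (2 * dot v a / dot a a) *: a.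

Lemma dot_neq0 a : a != 0 -> dot a a != 0.
Proof.
apply: contra_neq => a0; apply/rowP => j; rewrite mxE.
have sq_ge0 (i : 'I_n) : true -> 0 <= a 0 i * a^T i 0.
  by move=> _; rewrite mxE -expr2 sqr_ge0.
move: a0; rewrite /dot mxE => /eqP.
rewrite psumr_eq0 // => /allP /(_ j (mem_index_enum _)) /=.
by rewrite mxE mulf_eq0 orbb => /eqP.
Qed.

Lemma reflK a : a != 0 -> involutive (refl a).
Proof.
move=> /dot_neq0 a0 v; rewrite /refl.
set c := 2 * dot v a / dot a a.
have -> : dot (v - c *: a) a = - dot v a.
  rewrite /dot mulmxBl -scalemxAl !mxE -!/(dot _ _).
  have E u : \sum_j u 0 j * a^T j 0 = dot u a by rewrite /dot mxE.
  by rewrite !E /c divfK // mulr_natl mulr2n opprD addrA subrr add0r.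
by rewrite mulrN mulNr scaleNr opprK subrK.
Qed.

End Reflection.

(* A crystallographic root system in Euclidean space together with a choice of
   simple roots and the resulting positive roots. Neither spanning nor
   reducedness is required, so both conventions on these are covered. *)
Record based_root_system (R : realFieldType) (n : nat) := BasedRootSystem {
  roots : {fset 'rV[R]_n};
  roots_neq0 : 0 \notin roots;
  roots_refl : forall a b, a \in roots -> b \in roots -> refl a b \in roots;
  roots_cryst : forall a b, a \in roots -> b \in roots ->
    exists z : int, 2 * dot b a / dot a a = z%:~R;
  simple_roots : {set roots};
  pos_roots : {set roots};
  simple_free : free [seq \val a | a <- enum simple_roots];
  pos_rootsP : forall b : roots, b \in pos_roots <->
    exists c : roots -> nat, \val b = \sum_(a in simple_roots) \val a *+ c a;
  roots_pos_or_neg : forall b : roots, b \in pos_roots \/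
    exists2 g : roots, g \in pos_roots & \val b = - \val g
}.

Section RootSystem.
Variables (R : realFieldType) (n : nat) (Phi : based_root_system R n).

Definition root_type : finType := roots Phi.

Local Notation Delta := (simple_roots Phi : {set root_type}).
Local Notation Rp := (pos_roots Phi : {set root_type}).

Definition neg_roots : {set root_type} :=
  [set b | [exists g in Rp, \val b == - \val g]].

Definition refl_root (a b : root_type) : root_type :=
  FSetSub (roots_refl (valP a) (valP b)).

Lemma refl_root_inj a : injective (refl_root a).
Proof.
have a0 : \val a != 0.
  by apply/eqP => E; have := roots_neq0 Phi; rewrite -E (valP a).
by move=> b c /(congr1 val) /= /(can_inj (reflK a0)) /val_inj.
Qed.

Definition root_refl (a : root_type) : {perm root_type} := perm (@refl_root_inj a).

(* The product in MathComp's permutation groups is (s * t) x = t (s x); wmul is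
   the usual composition, (wmul x y) b = x (y b). *)
Definition wmul (x y : {perm root_type}) : {perm root_type} := (y * x)%g.

(* The standard parabolic subgroup for J \subset Delta; by definition the
   Weyl group is generated by all the reflections. *)
Definition parabolic (J : {set root_type}) : {group {perm root_type}} :=
  <<[set root_refl a | a in J]>>%G.

Definition weyl : {group {perm root_type}} := <<[set root_refl a | a : root_type]>>%G.

(* Automorphisms of the root system, recorded by their action on the roots. *)
Definition root_aut (p : {perm root_type}) : Prop :=
  exists f : {linear 'rV[R]_n -> 'rV[R]_n},
    forall b : root_type, \val (p b) = f (\val b).

Definition is_twist (p : {perm root_type}) : Prop :=
  root_aut p /\ p @: Delta = Delta.

(* The semidirect product is formed inside the automorphism group of the root
   system; a twist lying in the Weyl group is trivial. *)
Definition twisted_weyl (Omega : {group {perm root_type}}) : {group {perm root_type}} :=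
  (Omega <*> weyl)%G.

Definition inversions (w : {perm root_type}) : {set root_type} :=
  [set b in Rp | w b \in neg_roots].

Definition len (w : {perm root_type}) : nat := #|inversions w|.

(* porbit w b is the set of all w^i(b) with i an integer. *)
Definition stable_roots (w : {perm root_type}) : {set root_type} :=
  [set b | (porbit w b \subset Rp) || (porbit w b \subset neg_roots)].

Definition parabolic_roots (J : {set root_type}) : {set root_type} :=
  [set b : root_type | \val b \in <<[seq \val a | a <- enum J]>>%VS].

Definition convex (w : {perm root_type}) : Prop :=
  exists2 J : {set root_type}, J \subset Delta & stable_roots w = parabolic_roots J.

Definition longest (G : {group {perm root_type}}) : {perm root_type} :=
  [arg max_(x > 1%g in G) len x].

(* If stable_roots w = parabolic_roots J with J \subset Delta, then
   J = Delta :&: stable_roots w. *)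
Definition pb (w : {perm root_type}) : {perm root_type} :=
  wmul (longest weyl) (longest (parabolic (Delta :&: stable_roots w))).

(* weak_le x y is x <= y in the weak left order. *)
Definition weak_le (x y : {perm root_type}) : Prop :=
  len y = (len (wmul y x^-1%g) + len x)%N.

Section Braids.
Variable Omega : {group {perm root_type}}.
Local Notation W := (twisted_weyl Omega).

(* Braids are represented by words [:: x1; ...; xk] in W, standing for
   b_x1 ... b_xk, modulo the congruence braid_eq. The relation b_1 = 1 makes
   the twists invertible in the monoid and makes b_1 a divisor of b_w^0 = 1. *)
Inductive braid_eq : seq {perm root_type} -> seq {perm root_type} -> Prop :=
| braid_refl b : braid_eq b b
| braid_sym b c : braid_eq b c -> braid_eq c b
| braid_trans b c d : braid_eq b c -> braid_eq c d -> braid_eq b d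
| braid_unit u v : braid_eq (u ++ 1%g :: v) (u ++ v)
| braid_mul u v x y : x \in W -> y \in W ->
    len (wmul x y) = (len x + len y)%N ->
    braid_eq (u ++ [:: x, y & v]) (u ++ wmul x y :: v).

Definition right_factor (b : seq {perm root_type}) (x : {perm root_type}) : Prop :=
  x \in W /\
  exists2 b' : seq {perm root_type}, {subset b' <= W} & braid_eq b (b' ++ [:: x]).

(* x is a right Deligne-Garside factor of b; it is unique up to left
   multiplication by twists. *)
Definition is_DG (b : seq {perm root_type}) (x : {perm root_type}) : Prop :=
  right_factor b x /\ forall y, right_factor b y -> weak_le y x.

(* DG(b) = p, understood up to twists. *)
Definition DG_eq (b : seq {perm root_type}) (p : {perm root_type}) : Prop :=
  exists2 x, is_DG b x & inversions x = inversions p.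

End Braids.
End RootSystem.

(* Main.v *)
Require Import Defs.
From HB Require Import structures.
From mathcomp Require Import all_boot all_order all_algebra all_fingroup.
From mathcomp Require Import finmap zify.

Set Implicit Arguments.
Unset Strict Implicit.
Unset Printing Implicit Defensive.

Import Order.TTheory GRing.Theory Num.Theory.
Local Open Scope ring_scope.

(** Reversing a word and inverting its letters is an anti-automorphism of the
    braid monoid that maps b_w^d to b_(w^-1)^d. Hence the theorem compares right
    and left divisors of b_w^d, and the link between the two sides is the
    longest element, which commutes with every braid up to conjugating it.

    Let J be the set of simple roots in R_st^w = R_J, and u the longest element of
    W_J. Since w and w^-1 permute the positive roots of R_J, the products w u and
    (w u w^-1) w are reduced, so b_w commutes with b_u up to conjugating u
    (wlong_commute). Suppose that b_w^d = b' b_x with x = pb(w).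
    Then b_w^d b_u = b' b_v with v = x u the longest element; moving u to
    the left, reversing, and moving v to the right gives
    b_(w^-1)^d b_t = c b_v' for some t with inversion set that of u and some v'
    which inverts every positive root. It remains to cancel b_t, that is, to
    derive that b_(w^-1)^d has a right factor m with the inversion set of pb(w)
    (right_factor_pb_inv). This m is the largest right factor, because
    no right factor of b_(w^-1)^d inverts a root of R_J (suffixes_preserves).

    Both last points rest on an explicit description of the simple right factors
    of a braid (suffixes): the right factors of b b_x are the elements below some
    m x, where m is a right factor of b and the product m x is reduced. Reading a
    word from left to right this defines a set of elements of W. That it depends
    only on the braid (suffixes_braid) is the substantial part; it amounts to
    factor_stepM, which needs joins in the weak order (exists_join).

    The weak order enters through inversion sets only: a product x y is reduced
    iff inversions y is contained in inversions (x y), and x <= y iff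
    inversions x is contained in inversions y. *)

(** * Roots and nonnegative combinations of simple roots *)

Lemma gen_prop_ind (gT : finGroupType) (A : {set gT}) (Q : gT -> Prop) :
  Q 1%g -> (forall x y, Q x -> Q y -> Q (x * y)%g) ->
  (forall x, x \in A -> Q x) -> forall x, x \in <<A>>%g -> Q x.
Proof.
move=> Q1 QM QA x /gen_prodgP[k [c cA ->]].
by apply: big_ind => // i _; apply: QA.
Qed.

Section Roots.
Variables (R : realFieldType) (n : nat) (Phi : based_root_system R n).
Local Notation T := (root_type Phi).
Local Notation Delta := (simple_roots Phi : {set T}).
Local Notation Rp := (pos_roots Phi : {set T}).
Local Notation span J := (<<[seq \val a | a <- enum J]>>%VS).
Implicit Types (a b g : T) (v : 'rV[R]_n) (J : {set T}) (x y z w : {perm T}).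

Lemma simple_span a J : a \in J -> \val a \in span J.
Proof. by move=> aJ; apply/memv_span/map_f; rewrite mem_enum. Qed.

(** The simple roots are free, so if the coefficient of a were nonzero, then a
    would lie in the span of the other simple roots. *)
Lemma coef_notin_span (c : T -> nat) J a :
  J \subset Delta -> a \in Delta -> a \notin J ->
  \sum_(g in Delta) \val g *+ c g \in span J -> c a = 0%N.
Proof.
move=> JD aD aJ; rewrite (bigD1 a) //= => sumJ.
have subJ : (span J <= span (Delta :\ a))%VS.
  apply/span_subvP => v /mapP[g]; rewrite mem_enum => gJ ->.
  apply: simple_span; rewrite !inE (subsetP JD) // andbT.
  by apply: contraNneq aJ => <-.
have restV : \sum_(g in Delta | g != a) \val g *+ c g \in span (Delta :\ a).
  apply: memv_suml => g /andP[gD ga]; rewrite -scaler_nat memvZ //.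
  by apply: simple_span; rewrite !inE ga.
have caV : \val a *+ c a \in span (Delta :\ a).
  by have := memvB (subvP subJ _ sumJ) restV; rewrite addrK.
have : free [seq \val g | g <- a :: enum (Delta :\ a)].
  rewrite (perm_free (Y := [seq \val g | g <- enum Delta])) ?simple_free //.
  apply/perm_map/uniq_perm; rewrite /= ?enum_uniq ?mem_enum ?inE ?eqxx //.
  move=> g; rewrite !inE !mem_enum !inE.
  by case: eqVneq => //= ->; rewrite aD.
rewrite /= free_cons => /andP[aV _]; apply/eqP/negPn/negP => c0.
case/negP: aV; rewrite -(scalerK (a := (c a)%:R) _ (\val a)) ?unitfE ?pnatr_eq0 //.
by rewrite memvZ // scaler_nat.
Qed.

Definition natcomb v := exists c : T -> nat, v = \sum_(a in Delta) \val a *+ c a.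

Lemma natcomb0 : natcomb 0.
Proof. by exists (fun=> 0%N); rewrite big1. Qed.

Lemma natcombD v v' : natcomb v -> natcomb v' -> natcomb (v + v').
Proof.
move=> [c ->] [c' ->]; exists (fun a => c a + c' a)%N.
by rewrite -big_split /=; apply: eq_bigr => a _; rewrite mulrnDr.
Qed.

Lemma natcombMn v k : natcomb v -> natcomb (v *+ k).
Proof.
by move=> cv; elim: k => [|k IHk]; [exact: natcomb0 | rewrite mulrS; apply: natcombD].
Qed.

Lemma natcomb_sum J (F : T -> 'rV[R]_n) :
  (forall a, a \in J -> natcomb (F a)) -> natcomb (\sum_(a in J) F a).
Proof. by move=> FJ; apply: big_ind => //; [exact: natcomb0 | exact: natcombD]. Qed.

Lemma pos_natcomb b : b \in Rp <-> natcomb (\val b).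
Proof. exact: pos_rootsP. Qed.

Lemma pos_in_span b J : J \subset Delta -> b \in Rp -> \val b \in span J ->
  exists c : T -> nat, \val b = \sum_(a in J) \val a *+ c a.
Proof.
move=> JD /pos_natcomb[c bE] bJ; exists c; rewrite bE (big_setID J) /=.
rewrite (setIidPr JD) [X in _ + X]big1 ?addr0 // => a; rewrite inE => /andP[aJ aD].
by rewrite (coef_notin_span JD aD aJ) ?mulr0n -?bE.
Qed.

(** Coefficients are nonnegative, so they cannot cancel in a sum: those outside J
    vanish already in each summand. *)
Lemma natcomb_span_sum v v' J : J \subset Delta -> natcomb v -> natcomb v' ->
  v + v' \in span J -> v \in span J.
Proof.
move=> JD [c ->] [c' ->]; rewrite -big_split /=.
under eq_bigr do rewrite -mulrnDr.
move=> sumJ; apply: memv_suml => a aD; rewrite -scaler_nat.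
have [aJ | aJ] := boolP (a \in J); first by rewrite memvZ // simple_span.
have := @coef_notin_span (fun a => c a + c' a)%N _ _ JD aD aJ sumJ.
by move/eqP; rewrite addn_eq0 => /andP[/eqP-> _]; rewrite scale0r mem0v.
Qed.

Lemma root_neq0 b : \val b != 0.
Proof. by apply: contraNneq (roots_neq0 Phi) => <-; apply: valP. Qed.

Definition root_opp b : T := refl_root b b.

Lemma val_root_opp b : \val (root_opp b) = - \val b.
Proof.
rewrite /= /refl mulfK ?dot_neq0 ?root_neq0 //.
by rewrite scaler_nat mulr2n opprD addrA subrr add0r.
Qed.

Lemma root_oppK : involutive root_opp.
Proof. by move=> b; apply: val_inj; rewrite !val_root_opp opprK. Qed.

Lemma span_set0 : span (set0 : {set T}) = 0%VS.
Proof. by rewrite enum_set0 span_nil. Qed.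

Lemma pos_opp b : (root_opp b \in Rp) = (b \notin Rp).
Proof.
apply/idP/idP => [obP | bP].
  apply/negP => /pos_natcomb bP; case/negP: (root_neq0 b).
  move/pos_natcomb: obP => obP.
  have := natcomb_span_sum (sub0set Delta) bP obP.
  by rewrite val_root_opp subrr mem0v span_set0 memv0 => ->.
case: (@roots_pos_or_neg _ _ Phi b) => [bP' | [g gP bE]].
  by rewrite bP' in bP.
suff -> : root_opp b = g by [].
by apply: val_inj; rewrite val_root_opp bE opprK.
Qed.

Lemma neg_rootsE b : (b \in neg_roots Phi) = (b \notin Rp).
Proof.
rewrite inE -pos_opp; apply/existsP/idP => [[g /andP[gP /eqP bE]] | obP].
  suff -> : root_opp b = g by [].
  by apply: val_inj; rewrite val_root_opp bE opprK.
by exists (root_opp b); rewrite obP val_root_opp opprK eqxx.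
Qed.

Lemma mem_inversions w b : (b \in inversions w) = (b \in Rp) && (w b \notin Rp).
Proof. by rewrite inE neg_rootsE. Qed.

(** The sign of a root outside the span of J is read off from its coefficients
    outside J, which only depend on its class modulo that span. *)
Lemma pos_mod_span J b g : J \subset Delta -> b \in Rp -> \val b \notin span J ->
  \val g - \val b \in span J -> g \in Rp.
Proof.
move=> JD bP bJ gbJ; apply: contraNT bJ; rewrite -pos_opp => ogP.
apply: (natcomb_span_sum JD (v' := \val (root_opp g))).
- exact/pos_natcomb.
- exact/pos_natcomb.
by rewrite val_root_opp -opprB memvN.
Qed.

Lemma root_aut1 : root_aut (1%g : {perm T}).
Proof. by exists (@idfun 'rV[R]_n) => b; rewrite perm1. Qed.

Lemma root_autM x y : root_aut x -> root_aut y -> root_aut (x * y)%g.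
Proof. by move=> [f fE] [h hE]; exists (h \o f) => b; rewrite permM hE fE. Qed.

Lemma root_autV x : root_aut x -> root_aut (x^-1)%g.
Proof.
move=> xA; rewrite invg_expg; elim: (#[x]%g.-1) => [|k IHk].
  by rewrite expg0; apply: root_aut1.
by rewrite expgS; apply: root_autM.
Qed.

Lemma refl_is_linear (a : 'rV[R]_n) : linear (refl a).
Proof.
move=> k u u'; rewrite /refl /dot mulmxDl -scalemxAl !mxE.
rewrite mulrDr mulrDl scalerDl opprD addrACA scalerBr; congr (_ - _ + _).
by rewrite scalerA mulrCA !mulrA.
Qed.

Lemma root_aut_refl a : root_aut (root_refl a).
Proof.
pose L := GRing.isLinear.Build R _ _ _ (refl (\val a)) (@refl_is_linear (\val a)).
pose f : {linear 'rV[R]_n -> 'rV[R]_n} := HB.pack (refl (\val a)) L.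
by exists f => b; rewrite permE.
Qed.

Lemma aut_opp w b : root_aut w -> w (root_opp b) = root_opp (w b).
Proof.
by move=> [f fE]; apply: val_inj; rewrite val_root_opp !fE val_root_opp linearN.
Qed.

(** An automorphism is linear, so the images of the positive roots in the span of
    J are nonnegative combinations of the images of J. *)
Lemma aut_pos w J b : root_aut w -> J \subset Delta -> b \in Rp -> \val b \in span J ->
  (forall a, a \in J -> w a \in Rp) -> w b \in Rp.
Proof.
move=> [f fE] JD bP bJ wJ; have [c bE] := pos_in_span JD bP bJ.
apply/pos_natcomb; rewrite fE bE linear_sum; apply: natcomb_sum => a aJ.
by rewrite linearMn -fE; apply/natcombMn/pos_natcomb/wJ.
Qed.

Lemma aut_neg w J b : root_aut w -> J \subset Delta -> b \in Rp -> \val b \in span J ->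
  (forall a, a \in J -> w a \notin Rp) -> w b \notin Rp.
Proof.
move=> [f fE] JD bP bJ wJ; have [c bE] := pos_in_span JD bP bJ.
rewrite -pos_opp; apply/pos_natcomb; rewrite val_root_opp fE bE linear_sum -sumrN.
apply: natcomb_sum => a aJ; rewrite linearMn -mulNrn -fE -val_root_opp.
by apply/natcombMn/pos_natcomb; rewrite pos_opp wJ.
Qed.

(** * Inversion sets and reduced products *)

Lemma wmulE x y b : wmul x y b = x (y b).
Proof. exact: permM. Qed.

Lemma wmulA x y z : wmul x (wmul y z) = wmul (wmul x y) z.
Proof. exact/esym/mulgA. Qed.

(** Equivalent to the length being additive, see reduced_len. This form is boolean
    and makes the weak order comparison of y with x y explicit. *)
Definition reduced x y := inversions y \subset inversions (wmul x y).

Lemma reducedP x y : root_aut x -> root_aut y ->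
  reflect (forall g, g \in inversions x -> (y^-1)%g g \in Rp) (reduced x y).
Proof.
move=> xA yA; apply: (iffP subsetP) => [sub g | pre b]; rewrite !mem_inversions ?wmulE.
  case/andP=> gP xgP; apply: contraT => ygP.
  have := sub (root_opp ((y^-1)%g g)); rewrite !mem_inversions wmulE.
  rewrite !aut_opp // permKV !pos_opp ygP gP !negbK /= (negPf xgP).
  by move/(_ isT).
case/andP=> bP ybP; rewrite bP /=; apply: contraT => /negPn xybP.
have := pre (root_opp (y b)); rewrite mem_inversions pos_opp ybP aut_opp // pos_opp xybP.
by rewrite -aut_opp // permK pos_opp bP; move/(_ isT).
Qed.

Lemma opp_perm_inj x : injective (fun b => root_opp (x b)).
Proof. by move=> b g /(can_inj root_oppK)/perm_inj. Qed.

(** Roots that are inverted by y and brought back by x are lost twice: they are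
    inversions of y, and the negatives of their images under y are inversions of
    x, but they do not count for x y. *)
Lemma card_inversions_mul x y : root_aut x -> root_aut y ->
  (len (wmul x y) + (#|inversions y :\: inversions (wmul x y)|).*2 = len x + len y)%N.
Proof.
move=> xA yA; pose S := [set g | (y^-1)%g g \in Rp].
have xS : inversions x :&: S = [set y b | b in inversions (wmul x y) :\: inversions y].
  apply/setP => g; rewrite -(permKV y g); set b := (y^-1)%g g.
  rewrite (mem_imset _ _ perm_inj) in_setI in_setD !mem_inversions inE !wmulE permK.
  by case: (b \in Rp); case: (y b \in Rp); case: (x (y b) \in Rp).
have xD : inversions x :\: S =
    [set root_opp (y b) | b in inversions y :\: inversions (wmul x y)].
  apply/setP => g; set b := (y^-1)%g (root_opp g).
  have -> : g = root_opp (y b) by rewrite /b permKV root_oppK.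
  rewrite (mem_imset _ _ (@opp_perm_inj y)) !in_setD !mem_inversions inE !wmulE.
  have -> : (y^-1)%g (root_opp (y b)) = root_opp b by rewrite -aut_opp // permK.
  rewrite aut_opp // !pos_opp.
  by case: (b \in Rp); case: (y b \in Rp); case: (x (y b) \in Rp).
have xE : (len x = #|inversions (wmul x y) :\: inversions y|
                   + #|inversions y :\: inversions (wmul x y)|)%N.
  rewrite /len -(cardsID S) xS xD !card_imset //; first exact: opp_perm_inj.
  exact: perm_inj.
have := cardsID (inversions y) (inversions (wmul x y)).
have := cardsID (inversions (wmul x y)) (inversions y).
by rewrite setIC xE /len; lia.
Qed.

Lemma reduced_len x y : root_aut x -> root_aut y ->
  reflect (len (wmul x y) = (len x + len y)%N) (reduced x y).
Proof.
move=> xA yA; have lenE := card_inversions_mul xA yA.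
rewrite /reduced -setD_eq0 -cards_eq0; apply: (iffP eqP); lia.
Qed.

Lemma len_mul_le x y : root_aut x -> root_aut y -> (len (wmul x y) <= len x + len y)%N.
Proof. by move=> xA yA; rewrite -card_inversions_mul // leq_addr. Qed.

Lemma mem_inversions_mul x y b : reduced x y ->
  (b \in inversions (wmul x y)) = (b \in inversions y) || (b \in Rp) && (y b \in inversions x).
Proof.
move=> /subsetP/(_ b); rewrite !mem_inversions wmulE.
by case: (b \in Rp) => //=; case: (y b \in Rp) => //= ->.
Qed.

Lemma reduced_mono x x' y : reduced x y -> reduced x' y ->
  inversions x \subset inversions x' ->
  inversions (wmul x y) \subset inversions (wmul x' y).
Proof.
move=> xy x'y /subsetP sub; apply/subsetP => b; rewrite !mem_inversions_mul //.
by case/orP=> [-> // | /andP[-> /sub->]]; rewrite orbT.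
Qed.

Lemma reduced_cancel x x' y : root_aut x -> root_aut y -> reduced x y ->
  inversions (wmul x y) \subset inversions (wmul x' y) ->
  inversions x \subset inversions x'.
Proof.
move=> xA yA /(reducedP xA yA) xy /subsetP sub; apply/subsetP => g gx.
have := sub ((y^-1)%g g); rewrite !mem_inversions !wmulE permKV xy //=.
by move: gx; rewrite mem_inversions => /andP[-> ->] /(_ isT).
Qed.

Lemma reduced_assocl x y z : root_aut x -> root_aut y -> root_aut z ->
  reduced y z -> reduced x (wmul y z) -> reduced x y /\ reduced (wmul x y) z.
Proof.
move=> xA yA zA; have xyA : root_aut (wmul x y) by apply: root_autM.
have yzA : root_aut (wmul y z) by apply: root_autM.
move=> /(reduced_len yA zA) yz /(reduced_len xA yzA) xyz.
have le1 := len_mul_le xyA zA; have le2 := len_mul_le xA yA.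
by split; apply/reduced_len => //; move: xyz; rewrite wmulA; lia.
Qed.

Lemma reduced_assocr x y z : root_aut x -> root_aut y -> root_aut z ->
  reduced x y -> reduced (wmul x y) z -> reduced y z /\ reduced x (wmul y z).
Proof.
move=> xA yA zA; have xyA : root_aut (wmul x y) by apply: root_autM.
have yzA : root_aut (wmul y z) by apply: root_autM.
move=> /(reduced_len xA yA) xy /(reduced_len xyA zA) xyz.
have le1 := len_mul_le yA zA; have le2 := len_mul_le xA yzA.
by split; apply/reduced_len => //; move: xyz; rewrite -wmulA in le2 *; lia.
Qed.

Lemma len_inv x : root_aut x -> len (x^-1)%g = len x.
Proof.
move=> xA; have xVA := root_autV xA; rewrite /len.
have -> : inversions (x^-1)%g = [set root_opp (x b) | b in inversions x].
  apply/setP => g; set b := (x^-1)%g (root_opp g).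
  have gE : g = root_opp (x b) by rewrite /b permKV root_oppK.
  rewrite [in RHS]gE (mem_imset _ _ (@opp_perm_inj x)).
  rewrite !mem_inversions /b permKV aut_opp // !pos_opp negbK.
  by rewrite andbC.
by rewrite card_imset //; apply: opp_perm_inj.
Qed.

(** * Longest elements *)

Lemma simple_pos a : a \in Delta -> a \in Rp.
Proof.
move=> aD; apply/pos_natcomb; exists (fun g => (g == a) : nat).
rewrite (bigD1 a) //= eqxx big1 ?addr0 // => g /andP[_ /negPf->].
by rewrite mulr0n.
Qed.

Lemma root_refl_opp a : root_refl a a = root_opp a.
Proof. by rewrite permE; apply: val_inj. Qed.

Lemma weyl_aut x : x \in weyl Phi -> root_aut x.
Proof.
apply: gen_prop_ind => [||z /imsetP[a _ ->]]; [exact: root_aut1 | exact: root_autM | exact: root_aut_refl].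
Qed.

Lemma parabolic_sub_weyl J : parabolic J \subset weyl Phi.
Proof. by rewrite genS //; apply/subsetP => z /imsetP[a _ ->]; apply: imset_f. Qed.

Lemma refl_in_parabolic J a : a \in J -> root_refl a \in parabolic J.
Proof. by move=> aJ; apply/mem_gen/imset_f. Qed.

(** Elements of the parabolic subgroup of J move roots by vectors in the span of J.
    Together with the sign of roots in that span this determines inversion sets. *)
Definition trivial_mod J x := forall b, \val (x b) - \val b \in span J.

Lemma parabolic_trivial_mod J x : x \in parabolic J -> trivial_mod J x.
Proof.
apply: gen_prop_ind => [b | y z ytr ztr b | z /imsetP[a aJ ->] b].
- by rewrite perm1 subrr mem0v.
- by rewrite permM -(subrKA (\val (y b))) memvD.
rewrite permE /= /refl addrAC subrr add0r memvN memvZ //.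
exact: simple_span.
Qed.

Lemma trivial_mod_inversions J x : J \subset Delta -> trivial_mod J x ->
  inversions x \subset parabolic_roots J.
Proof.
move=> JD xtr; apply/subsetP => b; rewrite mem_inversions inE => /andP[bP].
by apply: contraNT => bJ; apply: (pos_mod_span JD bP bJ).
Qed.

(** If an element u of maximal length kept the simple root a of J positive, then
    u s_a would be reduced, hence longer. As 2a may be a root, s_a can invert more
    than a, but all its inversions are multiples of a. *)
Lemma longest_neg (G : {group {perm T}}) J : J \subset Delta ->
  (forall x, x \in G -> root_aut x) -> parabolic J \subset G ->
  longest G \in G /\ forall a, a \in J -> longest G a \notin Rp.
Proof.
move=> JD GA JG; rewrite /longest; case: arg_maxnP => [|u uG umax]; first exact: group1.
split=> // a aJ; apply/negP => uaP.
have aP : a \in Rp by rewrite simple_pos ?(subsetP JD).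
have aD : [set a] \subset Delta by rewrite sub1set (subsetP JD).
have sG : root_refl a \in G by rewrite (subsetP JG) // refl_in_parabolic.
have us : reduced u (root_refl a).
  apply/reducedP; [exact: GA | exact: root_aut_refl |] => g; rewrite mem_inversions.
  case/andP=> gP ugP; apply: contraNT ugP => sgP.
  apply: (aut_pos (GA _ uG) aD gP) => [|b /set1P-> //].
  have sJ : (root_refl a)^-1%g \in parabolic [set a].
    by rewrite groupV refl_in_parabolic ?set11.
  have /subsetP := trivial_mod_inversions aD (parabolic_trivial_mod sJ).
  by move/(_ g); rewrite mem_inversions gP sgP inE; apply.
have /reduced_len := us => /(_ (GA _ uG) (root_aut_refl a)) lenE.
have /umax : wmul u (root_refl a) \in G by rewrite groupM.
rewrite /geq /= lenE -[X in (_ <= X)%N]addn0 leq_add2l leqn0 cards_eq0 => /eqP/setP/(_ a).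
by rewrite mem_inversions aP root_refl_opp pos_opp aP inE.
Qed.

Lemma longest_parabolic J : J \subset Delta ->
  longest (parabolic J) \in parabolic J /\
  inversions (longest (parabolic J)) = Rp :&: parabolic_roots J.
Proof.
move=> JD.
have JA x : x \in parabolic J -> root_aut x.
  by move=> xJ; apply/weyl_aut/(subsetP (parabolic_sub_weyl J)).
have [uJ uneg] := longest_neg JD JA (subxx _); split=> //.
apply/eqP; rewrite eqEsubset subsetI (trivial_mod_inversions JD) ?andbT; last first.
  exact: parabolic_trivial_mod.
apply/andP; split; first by apply/subsetP => b; rewrite mem_inversions => /andP[].
apply/subsetP => b; rewrite inE mem_inversions => /andP[bP bJ]; rewrite bP.
by move: bJ; rewrite inE => bJ; apply: (aut_neg (JA _ uJ) JD bP bJ uneg).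
Qed.

Lemma pos_span_simple b : b \in Rp -> \val b \in span Delta.
Proof.
move=> /pos_natcomb[c ->]; apply: memv_suml => a aD.
by rewrite -scaler_nat memvZ // simple_span.
Qed.

Lemma longest_weyl : longest (weyl Phi) \in weyl Phi /\ inversions (longest (weyl Phi)) = Rp.
Proof.
have [wW wneg] := longest_neg (subxx Delta) weyl_aut (parabolic_sub_weyl Delta).
split=> //; apply/setP => b; rewrite mem_inversions.
have [bP | //] := boolP (b \in Rp).
exact: (aut_neg (weyl_aut wW) (subxx _) bP (pos_span_simple bP) wneg).
Qed.

Lemma full_inversions_neg x g : root_aut x -> inversions x = Rp ->
  (x g \notin Rp) = (g \in Rp).
Proof.
move=> xA xE; have neg h : h \in Rp -> x h \notin Rp.
  by rewrite -{1}xE mem_inversions => /andP[].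
apply/idP/idP => [|/neg //]; apply: contraNT; rewrite -pos_opp => /neg.
by rewrite aut_opp // pos_opp negbK.
Qed.

Lemma exists_simple_inversion x : root_aut x -> inversions x != set0 ->
  exists2 a, a \in Delta & a \in inversions x.
Proof.
move=> xA /set0Pn[b]; rewrite mem_inversions => /andP[bP xbP].
have [/existsP[a /andP[aD ax]] | none] := boolP [exists a in Delta, a \in inversions x].
  by exists a.
case/negP: xbP; apply: (aut_pos xA (subxx _) bP (pos_span_simple bP)) => a aD.
move/existsPn: none => /(_ a); by rewrite aD mem_inversions simple_pos //= negbK.
Qed.

(** * Joins in the weak order *)

Local Notation word := (seq {perm T}).
Local Notation wlong J := (longest (parabolic J)).

Section TwistedWeyl.
Variable Omega : {group {perm T}}.
Hypothesis Omega_twist : forall o, o \in Omega -> is_twist o.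
Local Notation W := (twisted_weyl Omega).

Lemma twisted_aut x : x \in W -> root_aut x.
Proof.
apply: gen_prop_ind => [||z /setUP[/Omega_twist[] // | /weyl_aut //]].
- exact: root_aut1.
- exact: root_autM.
Qed.

Lemma weyl_sub : weyl Phi \subset W.
Proof. exact: joing_subr. Qed.

Lemma wmul_in x y : x \in W -> y \in W -> wmul x y \in W.
Proof. by move=> xW yW; apply: groupM. Qed.

Lemma wlong_in J : J \subset Delta -> wlong J \in W.
Proof.
move=> JD; have [uJ _] := longest_parabolic JD.
by apply: (subsetP weyl_sub); apply: (subsetP (parabolic_sub_weyl J)).
Qed.

Lemma wmulKV x z : wmul (wmul x z^-1%g) z = x.
Proof. by rewrite /wmul mulKVg. Qed.

Lemma wmulK x z : wmul (wmul x z) z^-1%g = x.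
Proof. by rewrite /wmul mulKg. Qed.

Lemma reduced_wlong J z : J \subset Delta -> z \in W ->
  (forall a, a \in J -> (z^-1)%g a \in Rp) -> reduced (wlong J) z.
Proof.
move=> JD zW zJ; apply/reducedP => [||g]; try exact/twisted_aut; first exact/twisted_aut/wlong_in.
rewrite (longest_parabolic JD).2 inE => /andP[gP]; rewrite inE => gJ.
by apply: (aut_pos _ JD gP gJ zJ); apply/root_autV/twisted_aut.
Qed.

Lemma simple_in_wlong J a : J \subset Delta -> a \in J -> a \in inversions (wlong J).
Proof.
move=> JD aJ; rewrite (longest_parabolic JD).2 !inE simple_span // andbT.
by rewrite simple_pos ?(subsetP JD).
Qed.

(** In the reduced factorization c = (c z^-1) z, all positive roots in the span of
    J are inverted by c z^-1 once the roots of J are. Thus the least element above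
    all s_a z, a in J, is obtained from z by the longest element of J. *)
Lemma wlong_le J z c : J \subset Delta -> z \in W -> c \in W ->
  inversions z \subset inversions c -> {subset J <= inversions (wmul c z^-1%g)} ->
  reduced (wlong J) z /\ inversions (wmul (wlong J) z) \subset inversions c.
Proof.
move=> JD zW cW zc Jc.
have c'W : wmul c z^-1%g \in W by rewrite wmul_in ?groupV.
have c'z : reduced (wmul c z^-1%g) z by rewrite /reduced wmulKV.
have uz : reduced (wlong J) z.
  apply: reduced_wlong => // a /Jc; move/reducedP: c'z => H.
  by apply: H; apply: twisted_aut.
split=> //; rewrite -(wmulKV c z); apply: reduced_mono => //.
apply/subsetP => b; rewrite (longest_parabolic JD).2 inE mem_inversions => /andP[bP].
rewrite inE => bJ; rewrite bP.
apply: (aut_neg (twisted_aut c'W) JD bP bJ) => a /Jc.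
by rewrite mem_inversions => /andP[].
Qed.

Lemma le_wlong J z c : J \subset Delta -> z \in W ->
  reduced (wlong J) z -> inversions (wmul (wlong J) z) \subset inversions c ->
  {subset J <= inversions (wmul c z^-1%g)}.
Proof.
move=> JD zW uz; rewrite -{1}(wmulKV c z) => uzc a aJ.
have uA : root_aut (wlong J) by apply/twisted_aut/wlong_in.
by have /subsetP := reduced_cancel uA (twisted_aut zW) uz uzc; apply; apply: simple_in_wlong.
Qed.

Lemma exists_ascent z c : z \in W -> c \in W ->
  inversions z \subset inversions c -> inversions z != inversions c ->
  exists2 a, a \in Delta & a \in inversions (wmul c z^-1%g).
Proof.
move=> zW cW zc neq; have c'W : wmul c z^-1%g \in W by rewrite wmul_in ?groupV.
apply: exists_simple_inversion; first exact: twisted_aut.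
apply: contraNneq neq => c'0.
have /reduced_len : reduced (wmul c z^-1%g) z by rewrite /reduced wmulKV.
move/(_ (twisted_aut c'W) (twisted_aut zW)); rewrite wmulKV /len c'0 cards0 => lenE.
by rewrite eqEcard zc lenE leqnn.
Qed.

Definition is_join x y e := [/\ e \in W, inversions x \subset inversions e,
  inversions y \subset inversions e &
  forall c, c \in W -> inversions x \subset inversions c ->
    inversions y \subset inversions c -> inversions e \subset inversions c].

(** Joins exist in a finite bounded poset as soon as any two elements covering a
    common element z have a join; for s_a z and s_b z that join j is z multiplied
    by the longest element of the subgroup of {a, b}. For general x above s_a z
    and y above s_b z, first join x with j above s_a z, then join the result with y
    above s_b z. The induction is on the number of positive roots that z does not
    invert. *)
Lemma exists_join_above z x y : z \in W -> x \in W -> y \in W ->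
  inversions z \subset inversions x -> inversions z \subset inversions y ->
  exists e, is_join x y e.
Proof.
have [k] := ubnP (#|Rp| - len z); elim: k z x y => // k IHk z x y ltk zW xW yW zx zy.
have [zx' | neqx] := eqVneq (inversions z) (inversions x).
  by exists y; split=> //; rewrite -zx'.
have [zy' | neqy] := eqVneq (inversions z) (inversions y).
  by exists x; split=> //; rewrite -zy'.
have [a aD ax] := exists_ascent zW xW zx neqx.
have [b bD bY] := exists_ascent zW yW zy neqy.
have sD g : g \in Delta -> [set g] \subset Delta by rewrite sub1set.
have abD : [set a; b] \subset Delta by rewrite subUset !sub1set aD.
have sub1 c g : g \in inversions (wmul c z^-1%g) -> {subset [set g] <= inversions (wmul c z^-1%g)}.
  by move=> gc g' /set1P->.
have [az azx] := wlong_le (sD _ aD) zW xW zx (sub1 _ _ ax).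
have [bz bzy] := wlong_le (sD _ bD) zW yW zy (sub1 _ _ bY).
have red_pre g c : c \in W -> inversions z \subset inversions c ->
    g \in inversions (wmul c z^-1%g) -> (z^-1)%g g \in Rp.
  move=> cW zc gc; have /reducedP H : reduced (wmul c z^-1%g) z by rewrite /reduced wmulKV.
  by apply: H gc; apply: twisted_aut; rewrite ?wmul_in ?groupV.
have abz : reduced (wlong [set a; b]) z.
  apply: reduced_wlong => // g; rewrite !inE => /orP[] /eqP->.
  - exact: red_pre xW zx ax.
  - exact: red_pre yW zy bY.
set j := wmul (wlong [set a; b]) z.
have jW : j \in W by rewrite wmul_in ?wlong_in.
have jab := le_wlong abD zW abz (subxx (inversions j)).
have [_ azj] := wlong_le (sD _ aD) zW jW abz (sub1 _ _ (jab _ (set21 a b))).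
have [_ bzj] := wlong_le (sD _ bD) zW jW abz (sub1 _ _ (jab _ (set22 a b))).
have lt_wlong g : g \in Delta -> reduced (wlong [set g]) z ->
    (#|Rp| - len (wmul (wlong [set g]) z) < k)%N.
  move=> gD gz; have /twisted_aut gA := wlong_in (sD _ gD).
  have := reduced_len gA (twisted_aut zW) gz => lenE.
  have : (0 < len (wlong [set g]))%N.
    by apply/card_gt0P; exists g; apply: simple_in_wlong; rewrite ?sD ?set11.
  have : (len (wmul (wlong [set g]) z) <= #|Rp|)%N.
    by apply/subset_leq_card/subsetP => g'; rewrite mem_inversions => /andP[].
  rewrite lenE; move: (len (wlong _)) (len z) #|Rp| ltk => l lz N.
  by clear; lia.
have azW : wmul (wlong [set a]) z \in W by rewrite wmul_in ?wlong_in ?sD.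
have bzW : wmul (wlong [set b]) z \in W by rewrite wmul_in ?wlong_in ?sD.
have [p [pW xp jp pmin]] := IHk _ x j (lt_wlong a aD az) azW xW jW azx azj.
have [q [qW pq yq qmin]] := IHk _ p y (lt_wlong b bD bz) bzW pW yW (subset_trans bzj jp) bzy.
exists q; split=> //; first exact: subset_trans pq.
move=> c cW xc yc; apply: qmin => //; apply: pmin => //.
have zc := subset_trans zx xc.
have ac := le_wlong (sD _ aD) zW az (subset_trans azx xc).
have bc := le_wlong (sD _ bD) zW bz (subset_trans bzy yc).
apply: (wlong_le abD zW cW zc _).2 => g; rewrite in_set2 => /orP[] /eqP->.
- by apply: ac; apply: set11.
- by apply: bc; apply: set11.
Qed.

Lemma inversions1 : inversions (1%g : {perm T}) = set0.
Proof. by apply/setP => b; rewrite mem_inversions perm1 inE andbN. Qed.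

Lemma exists_join x y : x \in W -> y \in W -> exists e, is_join x y e.
Proof.
by move=> xW yW; apply: (@exists_join_above 1%g) => //; rewrite ?group1 ?inversions1 ?sub0set.
Qed.

(** * Simple right factors of a braid *)

(** Order ideals of the weak order on W; elements with the same inversion set,
    which differ by an element of length zero, belong to the same ideals. *)
Definition is_ideal (S : {set {perm T}}) := S \subset W /\
  forall m z, m \in S -> z \in W -> inversions z \subset inversions m -> z \in S.

(** If S is the set of right factors of b, this is the set of right factors of
    b b_x. *)
Definition factor_step (S : {set {perm T}}) x : {set {perm T}} :=
  [set z in W | [exists m in S, reduced m x && (inversions z \subset inversions (wmul m x))]].

(** The set of right factors of the braid of a word, see suffixes_factor and
    factor_suffixes. The right factors of the trivial braid are the elements of
    length zero. *)
Definition suffixes (b : word) : {set {perm T}} :=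
  foldl factor_step [set z in W | inversions z == set0] b.

Lemma factor_stepP (S : {set {perm T}}) x z : reflect
  [/\ z \in W & exists m, [/\ m \in S, reduced m x & inversions z \subset inversions (wmul m x)]]
  (z \in factor_step S x).
Proof.
rewrite inE; apply: (iffP andP) => [[zW /existsP[m /and3P[]]] | [zW [m [mS mx zmx]]]].
  by split=> //; exists m.
by split=> //; apply/existsP; exists m; rewrite mS mx.
Qed.

Lemma factor_step_ideal (S : {set {perm T}}) x : is_ideal (factor_step S x).
Proof.
split=> [|m z /factor_stepP[_ [m' [m'S m'x mm']]] zW zm].
  by apply/subsetP => z /factor_stepP[].
by apply/factor_stepP; split=> //; exists m'; rewrite (subset_trans zm mm').
Qed.

Lemma suffixes_rcons (b : word) x : suffixes (rcons b x) = factor_step (suffixes b) x.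
Proof. exact: foldl_rcons. Qed.

Lemma suffixes_ideal (b : word) : is_ideal (suffixes b).
Proof.
case/lastP: b => [|b x]; last by rewrite suffixes_rcons; apply: factor_step_ideal.
split=> [|m z]; first by apply/subsetP => z; rewrite inE => /andP[].
by rewrite !inE => /andP[_ /eqP->] zW; rewrite zW -subset0.
Qed.

Lemma factor_step1 S : is_ideal S -> factor_step S 1%g = S.
Proof.
move=> [SW Sle]; apply/setP => z; apply/factor_stepP/idP => [[zW [m [mS _]]] | zS].
  by rewrite /wmul mul1g; apply: Sle.
split; first exact: (subsetP SW).
by exists z; rewrite /reduced inversions1 sub0set /wmul mul1g.
Qed.

(** The elements z with z x reduced are those that invert none of the inversions of
    x^-1; they form the interval below w0 x^-1, whose inversion set is the
    complement. So the condition that z x be reduced is stable under joins. *)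
Lemma exists_disjoint_bound x : x \in W -> exists2 c, c \in W &
  forall z, z \in W -> (inversions z \subset inversions c) = reduced z x.
Proof.
move=> xW; have [w0W w0E] := longest_weyl; set w0 := longest _ in w0W w0E.
have w0neg g := full_inversions_neg g (weyl_aut w0W) w0E.
have {}w0W := subsetP weyl_sub _ w0W.
exists (wmul w0 x^-1%g); first by rewrite wmul_in ?groupV.
move=> z zW; apply/subsetP/(reducedP (twisted_aut zW) (twisted_aut xW)) => sub g gz.
  by have := sub g gz; rewrite mem_inversions wmulE w0neg => /andP[].
rewrite mem_inversions wmulE w0neg sub // andbT.
by move: gz; rewrite mem_inversions => /andP[].
Qed.

(** From left to right, let z <= m y with m <= m1 x and m1 in S. The factor m need not have the suffix
    x, but the join e of x and m does; it is below m1 x, and e y is still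
    reduced. Thus e = m2 x with m2 <= m1 in S, and z <= m2 x y. *)
Lemma factor_stepM S x y : is_ideal S -> x \in W -> y \in W -> reduced x y ->
  factor_step (factor_step S x) y = factor_step S (wmul x y).
Proof.
move=> [SW Sle] xW yW xy; have [xA yA] := (twisted_aut xW, twisted_aut yW).
apply/setP => z; apply/factor_stepP/factor_stepP => [] [zW [m [mS mr zm]]].
  case/factor_stepP: mS => mW [m1 [m1S m1x mm1]].
  have m1W := subsetP SW _ m1S; have mA := twisted_aut mW.
  have [e [eW xe me emin]] := exists_join xW mW.
  have em1 : inversions e \subset inversions (wmul m1 x).
    by apply: emin; rewrite ?wmul_in.
  have ey : reduced e y.
    have [c cW cP] := exists_disjoint_bound yW.
    by rewrite -cP //; apply: emin; rewrite ?cP.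
  have m2W : wmul e x^-1%g \in W by rewrite wmul_in ?groupV.
  have m2x : reduced (wmul e x^-1%g) x by rewrite /reduced wmulKV.
  have [_ m2xy] : reduced x y /\ reduced (wmul e x^-1%g) (wmul x y).
    by apply: reduced_assocr; rewrite ?wmulKV //; apply: twisted_aut.
  split=> //; exists (wmul e x^-1%g); split=> //.
    apply: (Sle m1) => //; apply: (reduced_cancel (twisted_aut m2W) xA m2x).
    by rewrite wmulKV.
  by rewrite wmulA wmulKV (subset_trans zm) ?reduced_mono.
have mW := subsetP SW _ mS.
have [mx mxy] := reduced_assocl (twisted_aut mW) xA yA xy mr.
split=> //; exists (wmul m x); rewrite -wmulA; split=> //.
by apply/factor_stepP; split; [rewrite wmul_in | exists m].
Qed.

Lemma suffixes_braid (b c : word) : braid_eq Omega b c -> suffixes b = suffixes c.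
Proof.
elim=> // [{}b {}c d _ -> _ -> // | u v | u v x y xW yW lenE].
  by rewrite /suffixes !foldl_cat /= factor_step1 //; apply: suffixes_ideal.
rewrite /suffixes !foldl_cat /= factor_stepM //; first exact: suffixes_ideal.
by apply/reduced_len; [exact: twisted_aut | exact: twisted_aut |].
Qed.

Lemma braid_cat (p q b c : word) : braid_eq Omega b c -> braid_eq Omega (p ++ b ++ q) (p ++ c ++ q).
Proof.
elim=> [{}b | {}b {}c _ | {}b {}c d _ + _ | u v | u v x y xW yW lenE].
- exact: braid_refl.
- exact: braid_sym.
- exact: braid_trans.
- by rewrite -!catA /= !(catA p); apply: braid_unit.
- by rewrite -!catA /= !(catA p); apply: braid_mul.
Qed.

Lemma braid_reduced (u v : word) x y : x \in W -> y \in W -> reduced x y ->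
  braid_eq Omega (u ++ [:: x, y & v]) (u ++ wmul x y :: v).
Proof.
by move=> xW yW xy; apply: braid_mul => //; apply/reduced_len => //; apply: twisted_aut.
Qed.

Lemma suffixes1 (b : word) : 1%g \in suffixes b.
Proof.
elim/last_ind: b => [|b x IHb]; first by rewrite inE group1 inversions1 eqxx.
rewrite suffixes_rcons; apply/factor_stepP; split; first exact: group1.
exists 1%g; rewrite /reduced inversions1 sub0set /wmul mulg1; split=> //.
Qed.

Lemma suffixes_factor (b : word) z : {subset b <= W} -> z \in suffixes b -> right_factor Omega b z.
Proof.
elim/last_ind: b z => [|b x IHb] z bW.
  rewrite inE => /andP[zW /eqP z0]; split=> //; exists [:: z^-1%g].
    by move=> y /[!inE] /eqP->; rewrite groupV.
  apply: braid_sym; apply: braid_trans (braid_unit Omega [::] [::]).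
  have := @braid_reduced [::] [::] z^-1%g z; rewrite /wmul mulgV; apply=> //.
    by rewrite groupV.
  by rewrite /reduced z0 sub0set.
rewrite suffixes_rcons => /factor_stepP[zW [m [mb mx zmx]]].
have xW : x \in W by apply: bW; rewrite mem_rcons inE eqxx.
have b'W : {subset b <= W} by move=> y yb; apply: bW; rewrite mem_rcons inE yb orbT.
have [mW [b' b'sub bE]] := IHb m b'W mb.
have mxW : wmul m x \in W by rewrite wmul_in.
split=> //; exists (rcons b' (wmul (wmul m x) z^-1%g)).
  move=> y; rewrite mem_rcons inE => /orP[/eqP-> | /b'sub //].
  by rewrite wmul_in ?groupV.
rewrite -!cats1; apply: braid_trans (braid_cat [::] [:: x] bE) _.
rewrite -!catA /=; apply: braid_trans (braid_reduced _ _ mW xW mx) _.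
apply: braid_sym; rewrite -{2}(wmulKV (wmul m x) z).
by apply: braid_reduced; rewrite ?wmul_in ?groupV // /reduced wmulKV.
Qed.

Lemma suffixes_last (b : word) z : z \in W -> z \in suffixes (rcons b z).
Proof.
move=> zW; rewrite suffixes_rcons; apply/factor_stepP; split=> //.
by exists 1%g; rewrite suffixes1 /reduced /wmul mulg1.
Qed.

Lemma factor_suffixes (b : word) z : right_factor Omega b z -> z \in suffixes b.
Proof. by case=> zW [b' _ /suffixes_braid->]; rewrite cats1 suffixes_last. Qed.

(** * Reversal and the longest element *)

Definition rev_inv (b : word) := rev [seq x^-1%g | x <- b].

Lemma rev_inv_cat (b c : word) : rev_inv (b ++ c) = rev_inv c ++ rev_inv b.
Proof. by rewrite /rev_inv map_cat rev_cat. Qed.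

Lemma braid_rev_inv (b c : word) :
  braid_eq Omega b c -> braid_eq Omega (rev_inv b) (rev_inv c).
Proof.
elim=> [{}b | {}b {}c _ | {}b {}c d _ + _ | u v | u v x y xW yW lenE].
- exact: braid_refl.
- exact: braid_sym.
- exact: braid_trans.
- rewrite !rev_inv_cat /rev_inv /= rev_cons cat_rcons invg1.
  exact: braid_unit.
rewrite !rev_inv_cat /rev_inv /= !rev_cons !cat_rcons /wmul invMg.
have <- : wmul y^-1%g x^-1%g = (x^-1 * y^-1)%g by [].
apply: braid_mul; rewrite ?groupV //.
have -> : wmul y^-1%g x^-1%g = (wmul x y)^-1%g by rewrite /wmul invMg.
rewrite (len_inv (twisted_aut (wmul_in xW yW))) lenE addnC.
by rewrite (len_inv (twisted_aut xW)) (len_inv (twisted_aut yW)).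
Qed.

Lemma full_reduced x y : inversions (wmul x y) = Rp -> reduced x y.
Proof.
by rewrite /reduced => ->; apply/subsetP => b; rewrite mem_inversions => /andP[].
Qed.

(** The longest element v has every x as a suffix and every x' as a prefix. With
    y = v x^-1 and x' = v x v^-1 one has v = y x = x' y, hence
    b_v b_x = b_x' b_y b_x = b_x' b_v. *)
Lemma longest_commute (v : {perm T}) (b : word) : v \in W -> inversions v = Rp -> {subset b <= W} ->
  exists c, braid_eq Omega (v :: b) (c ++ [:: v]).
Proof.
move=> vW vE; elim: b => [|x b IHb] bW; first by exists [::]; apply: braid_refl.
have xW : x \in W by apply: bW; rewrite inE eqxx.
have [|c cE] := IHb; first by move=> y yb; apply: bW; rewrite inE yb orbT.
pose y := wmul v x^-1%g; pose x' := wmul (wmul v x) v^-1%g.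
have yW : y \in W by rewrite wmul_in ?groupV.
have x'W : x' \in W by rewrite !wmul_in ?groupV.
have yx : wmul y x = v by apply: wmulKV.
have x'y : wmul x' y = v by rewrite /x' /y wmulA wmulKV wmulK.
exists (x' :: c).
have yx_red : reduced y x by apply: full_reduced; rewrite yx.
have x'y_red : reduced x' y by apply: full_reduced; rewrite x'y.
have vE1 := @braid_reduced [::] (x :: b) x' y x'W yW x'y_red.
have vE2 := @braid_reduced [:: x'] b y x yW xW yx_red.
rewrite /= x'y in vE1; rewrite /= yx in vE2.
apply: braid_trans (braid_sym vE1) (braid_trans vE2 _).
by have := braid_cat [:: x'] [::] cE; rewrite !cats0.
Qed.

(** * Elements preserving a parabolic subsystem and its positive roots *)

Definition preserves J x := forall b, b \in parabolic_roots J ->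
  x b \in parabolic_roots J /\ (x b \in Rp) = (b \in Rp).

Lemma preserves_span J x (f : {linear 'rV[R]_n -> 'rV[R]_n}) v :
  preserves J x -> (forall b, \val (x b) = f (\val b)) ->
  v \in span J -> f v \in span J.
Proof.
move=> xJ fE vJ; rewrite -(lfunE f).
suff sub : (linfun f @: span J <= span J)%VS by apply/(subvP sub)/memv_img.
rewrite limg_span; apply/span_subvP => v1 /mapP[v2 /mapP[a aJ ->] ->].
rewrite mem_enum in aJ; rewrite lfunE -fE.
by have [|+ _] := xJ a; rewrite inE // simple_span.
Qed.

(** The longest element of the parabolic subgroup of J, up to elements of length
    zero. In this form stability under conjugation by any w in W that preserves
    R_J and its positive roots, twists included, follows from the linearity of w
    alone. *)
Definition inverts_span J u :=
  [/\ u \in W, trivial_mod J u & forall b, b \in Rp -> b \in parabolic_roots J -> u b \notin Rp].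

Lemma inverts_span_longest J : J \subset Delta -> inverts_span J (wlong J).
Proof.
move=> JD; have [uJ uE] := longest_parabolic JD.
split=> [||b bP bJ]; [exact: wlong_in | exact: parabolic_trivial_mod |].
have : b \in inversions (wlong J) by rewrite uE in_setI bP.
by rewrite mem_inversions bP.
Qed.

Lemma trivial_mod_parabolic J u b : trivial_mod J u ->
  (u b \in parabolic_roots J) = (b \in parabolic_roots J).
Proof. by move=> utr; rewrite !inE -{1}(subrK (\val b) (\val (u b))) rpredDl ?utr. Qed.

Lemma inverts_spanV J u : inverts_span J u -> inverts_span J u^-1%g.
Proof.
move=> [uW utr uJ].
have uVtr : trivial_mod J u^-1%g.
  by move=> b; have := utr ((u^-1)%g b); rewrite permKV -opprB memvN.
split=> //; first by rewrite groupV.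
move=> b bP bJ; apply/negP => ubP; have := uJ _ ubP.
by rewrite permKV bP trivial_mod_parabolic // => /(_ bJ).
Qed.

Lemma inverts_span_inversions J u : J \subset Delta -> inverts_span J u ->
  inversions u = Rp :&: parabolic_roots J.
Proof.
move=> JD [uW utr uJ]; apply/setP => b; rewrite in_setI.
apply/idP/andP => [bu | [bP bJ]]; last by rewrite mem_inversions bP uJ.
by split; [move: bu; rewrite mem_inversions => /andP[] |
  apply: (subsetP (trivial_mod_inversions JD utr))].
Qed.

Lemma inverts_span_conj J w u : w \in W ->
  preserves J w -> preserves J w^-1%g -> inverts_span J u ->
  inverts_span J (wmul (wmul w u) w^-1%g).
Proof.
move=> wW wJ wVJ [uW utr uJ]; split.
- by rewrite !wmul_in ?groupV.
- have [f fE] := twisted_aut wW => b; rewrite !wmulE.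
  by rewrite -{2}(permKV w b) !fE -linearB; apply: (preserves_span wJ fE).
move=> b bP bJ; rewrite !wmulE; have [wbJ wbP] := wVJ _ bJ.
have [|_ ->] := wJ (u ((w^-1)%g b)); first by rewrite trivial_mod_parabolic.
by rewrite uJ // wbP.
Qed.

(** Both w u and (w u w^-1) w are reduced, because w and w^-1 keep the positive roots
    of R_J positive, while u^-1 and w u w^-1 invert only such roots. *)
Lemma wlong_commute J w u : J \subset Delta -> w \in W ->
  preserves J w -> preserves J w^-1%g -> inverts_span J u -> forall d,
  exists2 u', inverts_span J u' & braid_eq Omega (nseq d w ++ [:: u]) (u' :: nseq d w).
Proof.
move=> JD wW wJ wVJ uL; elim=> [|d [u1 u1L IHd]]; first by exists u => //; apply: braid_refl.
have u'L := inverts_span_conj wW wJ wVJ u1L; set u' := wmul _ _ in u'L.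
have [u1W _ _] := u1L; have [u'W _ _] := u'L; exists u' => //.
have := braid_cat [:: w] [::] IHd; rewrite !cats0 => /braid_trans; apply=> /=.
have wu1 : reduced w u1.
  apply/reducedP => [||g]; try exact: twisted_aut.
  rewrite mem_inversions => /andP[gP]; apply: contraNT => ugP.
  have : g \in inversions u1^-1%g by rewrite mem_inversions gP.
  rewrite (inverts_span_inversions JD (inverts_spanV u1L)) inE => /andP[_ gJ].
  by have [_ ->] := wJ g gJ.
have u'w : reduced u' w.
  apply/reducedP => [||g]; try exact: twisted_aut.
  rewrite (inverts_span_inversions JD u'L) in_setI => /andP[gP gJ].
  by have [_ ->] := wVJ g gJ.
apply: (braid_trans (@braid_reduced [::] _ _ _ wW u1W wu1)).
have := @braid_reduced [::] (nseq d w) _ _ u'W wW u'w.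
by rewrite /u' wmulKV => /braid_sym.
Qed.

(** An inversion of a reduced product m x is an inversion of x or is mapped by x to
    an inversion of m; neither occurs in R_J if x permutes its positive roots. *)
Lemma suffixes_preserves J (b : word) z :
  {subset b <= W} -> (forall x, x \in b -> preserves J x) ->
  z \in suffixes b -> inversions z \subset ~: parabolic_roots J.
Proof.
elim/last_ind: b z => [|b x IHb] z bW bJ.
  by rewrite inE => /andP[_ /eqP->]; apply: sub0set.
rewrite suffixes_rcons => /factor_stepP[_ [m [mb mx zmx]]].
have xb : x \in rcons b x by rewrite mem_rcons inE eqxx.
have sub y : y \in b -> y \in rcons b x by rewrite mem_rcons inE => ->; rewrite orbT.
have {IHb} mJ := IHb m (fun y yb => bW y (sub y yb)) (fun y yb => bJ y (sub y yb)) mb.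
apply: (subset_trans zmx); apply/subsetP => g; rewrite mem_inversions_mul // in_setC.
move=> gmx; apply/negP => gJ; have [xgJ xgP] := bJ x xb g gJ.
case/orP: gmx => [|/andP[gP /(subsetP mJ)]]; last by rewrite in_setC xgJ.
by rewrite mem_inversions xgP andbN.
Qed.

Lemma inv_full (v : {perm T}) : v \in W -> inversions v = Rp -> inversions v^-1%g = Rp.
Proof.
move=> vW vE; apply/eqP; rewrite eqEcard; apply/andP; split.
  by apply/subsetP => b; rewrite mem_inversions => /andP[].
by have := len_inv (twisted_aut vW); rewrite /len vE => ->.
Qed.

(** The right factor v^-1 of b_(w^-1)^d b_t is below a reduced product m t with m a
    right factor of b_(w^-1)^d. As v^-1 inverts all positive roots, so does m t, which
    forces m to invert exactly the positive roots that t^-1 keeps positive. *)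
Lemma right_factor_pb_inv J w d x : J \subset Delta -> w \in W ->
  preserves J w -> preserves J w^-1%g ->
  right_factor Omega (nseq d w) x -> inversions x = Rp :\: parabolic_roots J ->
  exists2 m, m \in suffixes (nseq d w^-1%g) & inversions m = Rp :\: parabolic_roots J.
Proof.
move=> JD wW wJ wVJ [xW [b' b'W bE]] xE.
have uL := inverts_span_longest JD; set u := wlong J in uL.
have uE := inverts_span_inversions JD uL; have uVE := inverts_span_inversions JD (inverts_spanV uL).
have [uW utr uJ] := uL.
have xu : reduced x u.
  apply/reducedP => [||g]; try exact: twisted_aut.
  rewrite xE inE => /andP[gJ gP]; apply: contraNT gJ => ugP.
  have : g \in inversions u^-1%g by rewrite mem_inversions gP.
  by rewrite uVE inE => /andP[].
have vW := wmul_in xW uW; have vE : inversions (wmul x u) = Rp.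
  apply/setP => b; rewrite mem_inversions_mul // xE uE in_setI in_setD.
  rewrite trivial_mod_parabolic //.
  have [bP | //] := boolP (b \in Rp); have [// | bJ /=] := boolP (b \in parabolic_roots J).
  have : b \notin inversions u by rewrite uE in_setI (negPf bJ) andbF.
  by rewrite mem_inversions bP /= negbK.
set v := wmul x u in vW vE.
(* Moving u to the left end of b_w^d b_u = b' b_v before reversing puts its inverse
   at the right end, where the definition of suffixes can split it off. *)
have [u' u'L u'E] := wlong_commute JD wW wJ wVJ uL d.
have [c cE] : exists c, braid_eq Omega (nseq d w^-1%g ++ [:: u'^-1%g]) (c ++ [:: v^-1%g]).
  have b'VW : {subset rev_inv b' <= W}.
    by move=> y; rewrite mem_rev => /mapP[y' /b'W y'W ->]; rewrite groupV.
  have [|c cE] := longest_commute _ (inv_full vW vE) b'VW; first by rewrite groupV.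
  exists c; apply: braid_trans cE.
  have : braid_eq Omega (u' :: nseq d w) (b' ++ [:: v]).
    apply: braid_trans (braid_sym u'E) _.
    apply: braid_trans (braid_cat [::] [:: u] bE) _.
    by rewrite -catA; apply: braid_reduced.
  move/braid_rev_inv; rewrite rev_inv_cat /= -cat1s rev_inv_cat.
  by rewrite /rev_inv map_nseq rev_nseq.
have [t'W _ t'J] := inverts_spanV u'L; have {}u'E := inverts_span_inversions JD u'L.
set t := (u'^-1)%g in t'W t'J cE; have tVE : inversions t^-1%g = Rp :&: parabolic_roots J.
  by rewrite invgK.
have tV g : g \in Rp -> ((t^-1)%g g \in Rp) = (g \notin parabolic_roots J).
  move=> gP; have := mem_inversions t^-1%g g; rewrite tVE in_setI gP /= => ->.
  by rewrite negbK.
have vVW : v^-1%g \in W by rewrite groupV.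
have := suffixes_last c vVW; rewrite -cats1 -(suffixes_braid cE) cats1 suffixes_rcons.
case/factor_stepP=> _ [m [mS mt]]; rewrite (inv_full vW vE) => /subsetP full.
have mW := subsetP (suffixes_ideal _).1 _ mS.
(* On R_J, m must keep g positive since m t is reduced; elsewhere, m t inverts the
   positive root t^-1 g, so m inverts g. *)
exists m => //; apply/setP => g; rewrite in_setD andbC.
apply/idP/andP => [gm | [gP gJ]].
  have gP : g \in Rp by move: gm; rewrite mem_inversions => /andP[].
  by rewrite gP -tV //; move/reducedP: mt => mt; split=> //; apply: mt => //; apply: twisted_aut.
have := full ((t^-1)%g g); rewrite tV // mem_inversions wmulE permKV => /(_ gJ).
by rewrite mem_inversions gP => /andP[].
Qed.

(** * Convex elements and the braid power bound *)

Lemma convexE w : convex w ->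
  stable_roots w = parabolic_roots (Delta :&: stable_roots w).
Proof.
case=> J JD wE; apply/setP => b; rewrite {1}wE !inE; apply/idP/idP; apply/subvP/span_subvP.
  move=> v /mapP[a]; rewrite mem_enum => aJ ->; apply: simple_span.
  by rewrite wE !inE (subsetP JD) // simple_span.
by move=> v /mapP[a]; rewrite mem_enum wE !inE => /andP[_ aJ] ->.
Qed.

Lemma stable_preserves w J : stable_roots w = parabolic_roots J -> preserves J w.
Proof.
move=> wE b; rewrite -wE => bS.
have wbO : w b \in porbit w b by have := mem_porbit w 1 b; rewrite expg1.
have wO : porbit w (w b) = porbit w b by apply/eqP; rewrite eq_porbit_mem.
split; first by rewrite inE wO; rewrite inE in bS.
have bO := porbit_id w b; move: bS; rewrite inE => /orP[] /subsetP sub.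
  by rewrite !sub.
by have := sub _ wbO; have := sub _ bO; rewrite !neg_rootsE => /negPf-> /negPf->.
Qed.

Lemma stable_rootsV w : stable_roots w^-1%g = stable_roots w.
Proof. by apply/setP => b; rewrite !inE !porbitV. Qed.

Lemma pb_inversions w : convex w -> inversions (pb w) = Rp :\: stable_roots w.
Proof.
move=> wC; set J := Delta :&: stable_roots w.
have JD : J \subset Delta by apply: subsetIl.
have [w0W w0E] := longest_weyl; have [_ uE] := longest_parabolic JD.
have w0neg g := full_inversions_neg g (weyl_aut w0W) w0E.
have wE : stable_roots w = parabolic_roots J by apply: convexE.
apply/setP => b; rewrite mem_inversions wmulE -/J w0neg in_setD wE [RHS]andbC.
have := mem_inversions (wlong J) b; rewrite uE in_setI.
by case: (b \in Rp) => //= ->; rewrite negbK.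
Qed.

Lemma DG_pb_inv w d : w \in W -> convex w ->
  DG_eq Omega (nseq d w) (pb w) -> DG_eq Omega (nseq d w^-1%g) (pb w).
Proof.
move=> wW wC [x [xF _]]; have wE := convexE wC; rewrite (pb_inversions wC).
have JD : Delta :&: stable_roots w \subset Delta by apply: subsetIl.
move: (Delta :&: _) => J in wE JD *; rewrite wE => xE.
have wJ := stable_preserves wE.
have wVJ : preserves J w^-1%g by apply: stable_preserves; rewrite stable_rootsV.
have wVW : w^-1%g \in W by rewrite groupV.
have [m mS mE] := right_factor_pb_inv JD wW wJ wVJ xF xE.
have sub (Q : {perm T} -> Prop) : Q w^-1%g -> forall y, y \in nseq d w^-1%g -> Q y.
  by move=> QwV y /nseqP[->].
have mW := subsetP (suffixes_ideal _).1 _ mS.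
exists m; last by rewrite mE (pb_inversions wC) wE.
split=> [|y yF]; first by apply: suffixes_factor => //; apply: sub.
have [yW _] := yF; have ym : inversions y \subset inversions m.
  have yJ : inversions y \subset ~: parabolic_roots J.
    by apply: (suffixes_preserves _ _ (factor_suffixes yF)); apply: sub.
  rewrite mE setDE subsetI yJ andbT.
  by apply/subsetP => b; rewrite mem_inversions => /andP[].
have my : reduced (wmul m y^-1%g) y by rewrite /reduced wmulKV.
rewrite /weak_le -(reduced_len _ _ my) ?wmulKV //; apply: twisted_aut => //.
by rewrite wmul_in ?groupV.
Qed.

End TwistedWeyl.
End Roots.

Theorem corollary1 (R : realFieldType) (n : nat) (Phi : based_root_system R n)
    (Omega : {group {perm root_type Phi}})
    (hOmega : forall o, o \in Omega -> is_twist o)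
    (w : {perm root_type Phi}) (hw : w \in twisted_weyl Omega) (hconv : convex w)
    (d : nat) :
  DG_eq Omega (nseq d w) (pb w) <-> DG_eq Omega (nseq d (w^-1)%g) (pb w).
Proof.
split; first exact: DG_pb_inv.
have hV : convex w^-1%g by case: hconv => J JD wE; exists J; rewrite ?stable_rootsV.
have pbV : pb w^-1%g = pb w by rewrite /pb stable_rootsV.
have := DG_pb_inv hOmega (w := w^-1%g) (d := d).
by rewrite invgK pbV groupV => /(_ hw hV).
Qed.
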